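(* Let $E$ be a real or complex locally convex topological vector space and let $f,g\in\Gamma_0(E)$ be fixed. For $s\in[0,1]$ set $$U_s(f,g)=\int_0^1\Big(f!_{st+(1-s)\frac12}g\Big)d\mu(t),\qquad d\mu(t)=\frac{dt}{t(1-t)\Big(\pi^2+\big(\log\frac{t}{1-t}\big)^2\Big)}\ \text{ on }(0,1).$$ The following assertions hold true: (i) The map $s\longmapsto U_s(f,g)$ is point-wisely convex on $[0,1]$. (ii) For any $s\in[0,1]$, $$f!g\leq U_s(f,g)\leq (f!g)\nabla_sL(f,g)\leq L(f,g).$$ (iii) $$\inf_{s\in[0,1]}U_s(f,g)=f!g\quad\text{and}\quad \sup_{s\in[0,1]}U_s(f,g)=L(f,g),$$ where the infimum and supremum are taken for the point-wise order. (iv) The map $s\longmapsto U_s(f,g)$ is point-wisely monotone increasing.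
   Context: $E^*$ is the topological dual of $E$, with duality bracket $\langle x^*,x\rangle$. Conventions in $[-\infty,+\infty]$: $a+(+\infty)=+\infty$ for every $a$, $(+\infty)-(+\infty)=+\infty$, $0\cdot(+\infty)=+\infty$; $a\le b$ means $b-a\ge 0$, with $-\infty\le a\le+\infty$ for all $a$. Functionals are ordered point-wise; integrals of functionals are taken point-wise. $\Gamma_0(E)$ is the set of all convex lower semi-continuous proper functionals $f:E\to\mathbb R\cup\{+\infty\}$. Conjugates: $f^*(x^* )=\sup_{x\in E}\{\Re e\langle x^*,x\rangle-f(x)\}$ on $E^*$; for $\varphi:E^*\to[-\infty,+\infty]$, $\varphi^*(x)=\sup_{x^*\in E^*}\{\Re e\langle x^*,x\rangle-\varphi(x^* )\}$ on $E$. For $\lambda\in(0,1)$: $f\nabla_\lambda g=(1-\lambda)f+\lambda g$, $f!_\lambda g=\big((1-\lambda)f^*+\lambda g^*\big)^*$, $f\sharp_\lambda g=\frac{\sin(\pi\lambda)}{\pi}\int_0^1\frac{t^{\lambda-1}}{(1-t)^\lambda}\,f!_tg\,dt$. By convention $f\nabla_0g=f!_0g=f\sharp_0g=f$ and $f\nabla_1g=f!_1g=f\sharp_1g=g$; the notation $\nabla_s$ is used with the same expression and conventions for arbitrary functionals. Write $f!g=f!_{1/2}g$. The logarithmic mean is $L(f,g)=\int_0^1 f\sharp_tg\,dt$. A map $s\mapsto F_s$ into functionals is point-wisely convex (increasing) if $s\mapsto F_s(x)$ is convex (non-decreasing) for every $x\in E$. *)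

(* Defs.v *)
From mathcomp Require Import all_boot all_order all_algebra.
From mathcomp Require Import all_classical all_reals all_analysis.
From mathcomp Require Import complex.

Set Implicit Arguments.
Unset Strict Implicit.
Unset Printing Implicit Defensive.

Import Order.TTheory GRing.Theory Num.Theory.
Import numFieldNormedType.Exports.

Local Open Scope classical_set_scope.
Local Open Scope ring_scope.

(** Conventions in [-oo, +oo].  Sums and differences are the *dual* ones ([%dE]),
    for which [(+oo) + (-oo) = (+oo) - (+oo) = +oo].  A product of a scalar
    with an extended real is only ever formed with a positive scalar, so the
    library's [0 * +oo = 0] is never used. *)

Variant scalar_kind := RealScalars | ComplexScalars.

Definition scalars (R : realType) (k : scalar_kind) : numFieldType :=
  match k with
  | RealScalars => R
  | ComplexScalars => R[i]%C
  end.

Definition real_part (R : realType) (k : scalar_kind) : scalars R k -> R :=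
  match k with
  | RealScalars => fun z : R => z
  | ComplexScalars => fun z : R[i]%C => complex.Re z
  end.

Definition of_real (R : realType) (k : scalar_kind) : R -> scalars R k :=
  match k with
  | RealScalars => fun r : R => r
  | ComplexScalars => fun r : R => (r%:C)%C
  end.

Record topological_dual (K : numFieldType) (E : tvsType K) := TopologicalDual {
  dual_form :> {linear E -> K^o};
  dual_form_continuous : continuous dual_form
}.

Section Conjugation.
Variables (R : realType) (k : scalar_kind) (E : tvsType (scalars R k)).
Implicit Types (f : E -> \bar R) (phi : topological_dual E -> \bar R).

Definition pairing (xs : topological_dual E) (x : E) : R :=
  real_part (xs x : scalars R k).

Definition conjugate f (xs : topological_dual E) : \bar R :=
  ereal_sup (range (fun x : E => ((pairing xs x)%:E - f x)%dE)).

Definition dual_conjugate phi (x : E) : \bar R :=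
  ereal_sup (range
    (fun xs : topological_dual E => ((pairing xs x)%:E - phi xs)%dE)).

Definition convex_functional f : Prop :=
  forall (x y : E) (t : R), 0 < t < 1 ->
  (f (of_real k (1 - t) *: x + of_real k t *: y)%R <=
     (((1 - t)%:E * f x)%E + (t%:E * f y)%E)%dE)%E.

Definition proper_functional f : Prop :=
  (forall x, f x != -oo%E) /\ (exists x, f x != +oo%E).

Definition Gamma0 f : Prop :=
  [/\ convex_functional f, lower_semicontinuous f & proper_functional f].

End Conjugation.

Section Means.
Variable R : realType.

(** The arithmetic mean [F nabla_s G] of arbitrary functionals on any domain
    (it is used on [E] and on the dual of [E]). *)
Definition arithmetic_fmean (X : Type) (s : R) (F G : X -> \bar R) (x : X) : \bar R :=
  if s == 0 then F x else if s == 1 then G x else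
  (((1 - s)%:E * F x)%E + (s%:E * G x)%E)%dE.

Variables (k : scalar_kind) (E : tvsType (scalars R k)).
Implicit Types f g : E -> \bar R.

Definition harmonic_fmean (s : R) f g : E -> \bar R :=
  if s == 0 then f else if s == 1 then g else
  dual_conjugate (arithmetic_fmean s (conjugate f) (conjugate g)).

Definition geometric_fmean (s : R) f g (x : E) : \bar R :=
  if s == 0 then f x else if s == 1 then g x else
  ((sin (pi * s) / pi)%:E *
   \int[lebesgue_measure]_(t in `]0%R, 1%R[)
     ((t `^ (s - 1) / (1 - t) `^ s)%:E * harmonic_fmean t f g x))%E.

Definition logarithmic_fmean f g (x : E) : \bar R :=
  (\int[lebesgue_measure]_(t in `[0%R, 1%R]) geometric_fmean t f g x)%E.

Definition mu_density (t : R) : R :=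
  (t * (1 - t) * (pi ^+ 2 + ln (t / (1 - t)) ^+ 2))^-1.

Definition U_fmean f g (s : R) (x : E) : \bar R :=
  (\int[lebesgue_measure]_(t in `]0%R, 1%R[)
     ((mu_density t)%:E * harmonic_fmean (s * t + (1 - s) * 2^-1)%R f g x))%E.

End Means.

(** Infimum and supremum of a family of functionals for the point-wise order,
    the family being indexed by [s] in [D]. *)
Definition pointwise_inf (R : realType) (X : Type) (D : set R)
    (F : R -> X -> \bar R) (x : X) : \bar R :=
  ereal_inf [set F s x | s in D].

Definition pointwise_sup (R : realType) (X : Type) (D : set R)
    (F : R -> X -> \bar R) (x : X) : \bar R :=
  ereal_sup [set F s x | s in D].

Definition pointwise_le (R : realType) (X : Type) (F G : X -> \bar R) : Prop :=
  forall x, (F x <= G x)%E.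

Definition pointwisely_convex (R : realType) (X : Type) (D : set R)
    (F : R -> X -> \bar R) : Prop :=
  forall (s r l : R), D s -> D r -> 0 <= l <= 1 ->
  pointwise_le (F ((1 - l) * s + l * r)) (arithmetic_fmean l (F s) (F r)).

Definition pointwisely_increasing (R : realType) (X : Type) (D : set R)
    (F : R -> X -> \bar R) : Prop :=
  forall s r : R, D s -> D r -> s <= r -> pointwise_le (F s) (F r).

(* Main.v *)
(* For a point x, t |-> (f !_t g)(x) is on ]0, 1[ a supremum of affine functions
   p + q t, one for each x* at which both conjugates are finite; it is thus convex,
   measurable, and either identically -oo or bounded below.  The measure mu is a
   probability invariant under t |-> 1 - t (its distribution function is
   1/2 + atan (ln (t / (1 - t)) / pi) / pi), so that Jensen's inequality
   f ! g <= U_s follows from midpoint convexity, and U_s is convex in s because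
   s enters the parameter affinely.  Its density is the integral over s of the kernel
   sin (pi s) / pi * t^(s-1) / (1-t)^s, so by Tonelli U_1 = L; since U_0 = f ! g is
   the minimum of s |-> U_s, convexity makes this map increasing. *)
From HB Require Import structures.
Require Import Defs.
From mathcomp Require Import all_boot all_order all_algebra.
From mathcomp Require Import all_classical all_reals all_analysis.
From mathcomp Require Import ring lra measurable_realfun.

Set Implicit Arguments.
Unset Strict Implicit.
Unset Printing Implicit Defensive.

Import Order.TTheory GRing.Theory Num.Theory.
Import numFieldNormedType.Exports.

Local Open Scope classical_set_scope.
Local Open Scope ring_scope.

(** * The density of [mu] and the kernel of the geometric mean *)

Section kernels.
Variable R : realType.
Implicit Types s t : R.
Local Notation mu := (@lebesgue_measure R).

Lemma ln_odds t : 0 < t < 1 -> ln (t / (1 - t)) = ln t - ln (1 - t).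
Proof.
by move=> /andP[t0 t1]; rewrite ln_div// ?posrE ?subr_gt0.
Qed.

Lemma pi2D_gt0 (u : R) : 0 < pi ^+ 2 + u ^+ 2.
Proof. by rewrite ltr_wpDr ?sqr_ge0// exprn_gt0// pi_gt0. Qed.

Lemma mu_density_gt0 t : 0 < t < 1 -> 0 < mu_density t.
Proof.
by move=> /andP[t0 t1]; rewrite invr_gt0 !mulr_gt0 ?subr_gt0// pi2D_gt0.
Qed.

Lemma mu_density_ge0 t : 0 < t < 1 -> 0 <= mu_density t.
Proof. by move=> /mu_density_gt0/ltW. Qed.

Lemma mu_densityC t : 0 < t < 1 -> mu_density (1 - t) = mu_density t.
Proof.
move=> t01; have u01 : 0 < 1 - t < 1 by lra.
rewrite /mu_density !ln_odds// subKr; congr _^-1.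
by rewrite (mulrC (1 - t)) -(opprB (ln t)) sqrrN.
Qed.

(** The distribution function of [mu] lowered by 1/2, which makes it odd under t |-> 1 - t. *)
Definition mu_cdf t : R := atan ((ln t - ln (1 - t)) / pi) / pi.

Lemma is_derive_mu_cdf t : 0 < t < 1 -> is_derive t 1 mu_cdf (mu_density t).
Proof.
move=> t01; have /andP[t0 t1] := t01.
have d1 : is_derive t 1 (@ln R) t^-1 by exact: is_derive1_ln.
have d2 : is_derive t 1 (fun x : R => ln (1 - x)) (- (1 - t)^-1).
  have := @is_derive1_comp R (@ln R) (fun x => 1 - x) t (1 - t)^-1 (-1).
  rewrite mulrN1; apply.
    by apply: is_derive1_ln; rewrite subr_gt0.
  rewrite (_ : (fun x => 1 - x) = cst 1 - id); last exact/funext.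
  by apply: is_derive_eq; rewrite sub0r.
have d3 : is_derive t 1 (fun x : R => (ln x - ln (1 - x)) * pi^-1)
    ((t^-1 + (1 - t)^-1) * pi^-1).
  rewrite (_ : (fun _ => _) = pi^-1 \*: (@ln R - (fun x => ln (1 - x)))); last first.
    by apply/funext => x; rewrite /= mulrC.
  by apply: is_derive_eq; rewrite opprK /GRing.scale/= mulrC.
have d4 := @is_derive1_comp R (@atan R) _ t _ _ (is_derive1_atan _) d3.
rewrite (_ : mu_cdf =
  pi^-1 \*: (atan \o (fun x : R => (ln x - ln (1 - x)) * pi^-1))); last first.
  by apply/funext => x; rewrite /mu_cdf /= mulrC.
apply: is_derive_eq; rewrite /GRing.scale/= /mu_density ln_odds//.
set u := ln t - _.
have := pi2D_gt0 u; have := pi_gt0 R; move: (pi : R) => p p0 q0.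
by field; rewrite !lt0r_neq0 ?subr_gt0// addrC.
Qed.

Lemma mu_cdfC t : mu_cdf (1 - t) = - mu_cdf t.
Proof. by rewrite /mu_cdf subKr -opprB mulNr atanN mulNr. Qed.

Lemma continuous_mu_density t : 0 < t < 1 -> {for t, continuous (@mu_density R)}.
Proof.
move=> t01; have /andP[t0 t1] := t01.
have ct : {for t, continuous (fun x : R => 1 - x)}.
  by apply: cvgB; [exact: cvg_cst|exact: cvg_id].
apply: cvgV.
  by rewrite lt0r_neq0// !mulr_gt0 ?subr_gt0 ?pi2D_gt0.
apply: cvgM; first by apply: cvgM => //; exact: cvg_id.
apply: cvgD; first exact: cvg_cst.
apply: cvgM; (apply: continuous_comp;
  [|by apply: continuous_ln; rewrite divr_gt0// subr_gt0]).
all: by apply: cvgM; [exact: cvg_id|apply: cvgV => //; rewrite lt0r_neq0// subr_gt0].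
Qed.

Lemma measurable_mu_density :
  measurable_fun (`]0%R, 1%R[%classic : set R) (@mu_density R).
Proof.
apply: open_continuous_measurable_fun => [//|t].
by rewrite inE/= in_itv/= => /continuous_mu_density.
Qed.

(** At 1 - 1/(n+2) the odds t / (1 - t) are exactly n+1, so the sequence is atan (ln (n+1) / pi) /
    pi, with limit (pi / 2) / pi. *)
Lemma cvg_mu_cdf : mu_cdf (1 - n.+2%:R^-1) @[n --> \oo] --> (2^-1 : R).
Proof.
have -> : (fun n => mu_cdf (1 - n.+2%:R^-1)) =
    (fun n => atan (ln n.+1%:R / pi) / pi : R).
  apply/funext => n; rewrite /mu_cdf subKr.
  have -> : 1 - n.+2%:R^-1 = n.+1%:R / n.+2%:R :> R.
    apply: (@mulIf _ n.+2%:R); first by rewrite pnatr_eq0.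
    by rewrite mulfVK ?pnatr_eq0// mulrBl mul1r mulVf ?pnatr_eq0// -[n.+2%:R]natr1 addrK.
  by rewrite ln_div ?posrE// lnV ?posrE// opprK subrK.
rewrite (_ : 2^-1 = (pi / 2) / pi); last first.
  by rewrite mulrAC divff ?mul1r// lt0r_neq0 ?pi_gt0.
apply: cvgM; last exact: cvg_cst.
apply: (cvg_comp _ _ _ (@cvgy_atan R)).
apply/cvgryPge => A; near=> n.
rewrite ler_pdivlMr ?pi_gt0// -[leLHS]expRK ler_ln ?posrE ?expR_gt0//.
near: n; exists (Num.truncn (expR (A * pi))) => // n /= Hn.
by rewrite (le_trans (ltW (truncnS_gt _)))// ler_nat.
Unshelve. all: end_near. Qed.

(** The density is unbounded at both ends, so the fundamental theorem of calculus is applied on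
    compact intervals exhausting ]0, 1[, and monotone convergence gives the limit. Oddness of
    [mu_cdf] turns the two boundary terms into twice one value. *)
Lemma integral_mu_density : (\int[mu]_(t in `]0%R, 1%R[) (mu_density t)%:E = 1)%E.
Proof.
pose F n : set R := `[n.+2%:R^-1, 1 - n.+2%:R^-1]%classic.
have F01 n t : F n t -> 0 < t < 1.
  rewrite /F/= in_itv/= => /andP[nt tn].
  rewrite (lt_le_trans _ nt) ?invr_gt0//=.
  by rewrite (le_lt_trans tn)// gtrBl invr_gt0.
have FE : `]0%R, 1%R[%classic = \bigcup_n F n.
  apply/seteqP; split => [t|t [n _ /F01]]; last by rewrite /= in_itv.
  rewrite /= in_itv/= => /andP[t0 t1].
  have m0 : 0 < Num.min t (1 - t) by rewrite lt_min t0 subr_gt0.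
  (* Truncating 1 / min(t, 1 - t) yields an n with 1/(n+2) at most t and at most 1 - t. *)
  exists (Num.truncn (Num.min t (1 - t))^-1) => //.
  have : (Num.truncn (Num.min t (1 - t))^-1).+2%:R^-1 <= Num.min t (1 - t).
    rewrite -[leRHS]invrK lef_pV2 ?posrE ?invr_gt0//.
    rewrite ltW// (lt_trans (truncnS_gt _))// ltr_nat//.
  by rewrite le_min /F/= in_itv/= => /andP[-> ?]/=; rewrite lerBrDr -lerBrDl.
have ndF : nondecreasing_seq F.
  move=> m n mn; apply/subsetPset => t; rewrite /F/= !in_itv/= => /andP[a b].
  have mn' : n.+2%:R^-1 <= m.+2%:R^-1 :> R by rewrite lef_pV2 ?posrE// ler_nat.
  by rewrite (le_trans mn' a)/= (le_trans b)// lerB.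
have mF n : measurable (F n) by exact: measurable_itv.
have cF : (\int[mu]_(t in F n) (mu_density t)%:E @[n --> \oo] -->
    \int[mu]_(t in \bigcup_n F n) (mu_density t)%:E)%E.
  apply: ge0_nondecreasing_set_cvg_integral => //.
  - move=> n; apply/measurable_EFinP.
    apply: measurable_funS measurable_mu_density => //.
    by rewrite FE; exact: bigcup_sup.
  - by move=> n t /F01 t01; rewrite lee_fin mu_density_ge0.
(* The index is shifted because [F 0] is the single point 1/2, whereas [continuous_FTC2] needs
   distinct endpoints. *)
have intF n : (\int[mu]_(t in F n.+1) (mu_density t)%:E =
    (2 * mu_cdf (1 - n.+3%:R^-1))%:E)%E.
  have n3 : n.+3%:R^-1 < 1 - n.+3%:R^-1 :> R.
    have n2 : n.+3%:R^-1 < 2^-1 :> R by rewrite ltf_pV2 ?posrE// ltr_nat.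
    by rewrite ltrBrDr [ltRHS]splitr div1r ltrD.
  have D t : n.+3%:R^-1 <= t <= 1 - n.+3%:R^-1 -> 0 < t < 1.
    by move=> tn; apply: (F01 n.+1); rewrite /F/= in_itv.
  have C t : n.+3%:R^-1 <= t <= 1 - n.+3%:R^-1 -> {for t, continuous mu_cdf}.
    move=> /D/is_derive_mu_cdf dt.
    by apply/differentiable_continuous/derivable1_diffP; exact: ex_derive.
  rewrite (@continuous_FTC2 _ _ mu_cdf)//.
  - rewrite -EFinB [X in _ - mu_cdf X](_ : _ = 1 - (1 - n.+3%:R^-1)); last first.
      by rewrite subKr.
    by rewrite (mu_cdfC (1 - n.+3%:R^-1)) opprK mulr2n mulrDl mul1r.
  - apply: continuous_in_subspaceT => t; rewrite inE/= in_itv/= => /D.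
    exact: continuous_mu_density.
  - split.
    + move=> t; rewrite in_itv/= => /andP[a b].
      apply: ex_derive; apply: is_derive_mu_cdf; apply: D.
      by rewrite !ltW.
    + by apply: cvg_at_right_filter; apply: C; rewrite lexx ltW.
    + by apply: cvg_at_left_filter; apply: C; rewrite lexx ltW.
  - move=> t; rewrite in_itv/= => /andP[a b].
    rewrite derive1E; apply: derive_val; apply: is_derive_mu_cdf; apply: D.
    by rewrite !ltW.
have cF1 : (\int[mu]_(t in F n) (mu_density t)%:E @[n --> \oo] --> 1)%E.
  rewrite -(cvg_shiftS (fun n => \int[mu]_(t in F n) (mu_density t)%:E)%E) /=.
  under eq_fun do rewrite intF.
  apply: cvg_EFin; first exact: nearW.
  have : (2 * mu_cdf (1 - n.+3%:R^-1) @[n --> \oo] --> (2 * 2^-1 : R))%R.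
    apply: cvgM; first exact: cvg_cst.
    by have := cvg_mu_cdf; rewrite -(cvg_shiftS (fun n => mu_cdf (1 - n.+2%:R^-1))).
  by rewrite divff ?pnatr_eq0.
by rewrite FE; exact: (cvg_unique _ cF cF1).
Qed.

Definition kernel s t : R := sin (pi * s) / pi * (t `^ (s - 1) / (1 - t) `^ s).

(** For fixed t, s enters only through sin (pi s) and exp (u s), where u is the log-odds of t; the
    integral over s becomes elementary. *)
Lemma kernelE s t : 0 < t < 1 ->
  kernel s t = sin (pi * s) / pi * (expR ((ln t - ln (1 - t)) * s) / t).
Proof.
move=> /andP[t0 t1]; rewrite /kernel /powR !gt_eqF ?subr_gt0//.
congr (_ * _); rewrite -expRB.
rewrite (_ : _ - _ = (ln t - ln (1 - t)) * s - ln t); last by ring.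
by rewrite expRB lnK.
Qed.

Lemma kernel_ge0 s t : 0 < s < 1 -> 0 < t < 1 -> 0 <= kernel s t.
Proof.
move=> /andP[s0 s1] /andP[t0 t1].
have p0 := pi_gt0 R.
rewrite mulr_ge0 ?divr_ge0 ?powR_ge0 ?ltW// sin_gt0_pi//.
by rewrite mulr_gt0//= gtr_pMr.
Qed.

(** Comes from integrating sin (pi s) exp (u s) by parts twice; [c] collects the factors independent
    of s. *)
Definition kernel_primitive (u c s : R) :=
  c * (expR (u * s) * (u * sin (pi * s) - pi * cos (pi * s))).

Lemma is_derive_kernel_primitive u c s : is_derive s 1 (kernel_primitive u c)
  (c * (pi ^+ 2 + u ^+ 2) * (sin (pi * s) * expR (u * s))).
Proof.
have dM a : is_derive s 1 ( *%R a) a.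
  by rewrite -[X in is_derive _ _ _ X](mulr1 a); exact: is_deriveZ.
have dE := @is_derive1_comp R expR _ s _ _ (is_derive_expR _) (dM u).
have dS := @is_derive1_comp R (@sin R) _ s _ _ (is_derive_sin _) (dM pi).
have dC := @is_derive1_comp R (@cos R) _ s _ _ (is_derive_cos _) (dM pi).
rewrite (_ : kernel_primitive u c = c \*: ((expR \o *%R u) *
  ((u \*: (@sin R \o *%R pi)) - (pi \*: (@cos R \o *%R pi)))))//.
apply: is_derive_eq; rewrite /GRing.scale/=; move: (pi : R) => p.
rewrite -[(_ - _) s]/(u * sin (p * s) - p * cos (p * s)); ring.
Qed.

(** The source of U_1 = L. Between 0 and 1 the primitive grows by c pi (e^u + 1), and e^u + 1 = 1 /
    (1 - t). *)
Lemma integral_kernel t : 0 < t < 1 ->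
  (\int[mu]_(s in `]0%R, 1%R[) (kernel s t)%:E = (mu_density t)%:E)%E.
Proof.
move=> t01; have /andP[t0 t1] := t01.
set u := ln t - ln (1 - t).
have p0 := pi_gt0 R; have q0 := pi2D_gt0 u.
(* Chosen so that c (pi^2 + u^2) = 1 / (pi t), the factor that [kernelE] leaves in front. *)
pose c := (pi * t * (pi ^+ 2 + u ^+ 2))^-1.
pose f s := c * (pi ^+ 2 + u ^+ 2) * (sin (pi * s) * expR (u * s)).
have kf : (fun s => kernel s t) = f.
  apply/funext => s; rewrite kernelE// -/u /f /c.
  move: (sin _) (expR _) => a b; move: (pi : R) p0 q0 => p p0 q0.
  by field; rewrite !lt0r_neq0// addrC.
have cf : continuous f.
  move=> s; have cM a : {for s, continuous ( *%R a : R -> R)}.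
    exact: mulrl_continuous.
  apply: cvgM; first exact: cvg_cst.
  apply: cvgM; apply: continuous_comp => //.
    exact: continuous_sin.
  exact: continuous_expR.
rewrite -(@integral_itv_bndoo _ _ _ _ true false); last first.
  apply/measurable_EFinP; rewrite kf.
  by apply: measurable_funTS; exact: continuous_measurable_fun.
transitivity (\int[mu]_(s in `[0%R, 1%R]) (f s)%:E)%E; first by rewrite -kf.
have cK s : {for s, continuous (kernel_primitive u c)}.
  have := is_derive_kernel_primitive u c s => dK.
  by apply/differentiable_continuous/derivable1_diffP; exact: ex_derive.
rewrite (@continuous_FTC2 _ _ (kernel_primitive u c))//.
- rewrite -EFinB /kernel_primitive !mulr0 !mulr1 sinpi cospi sin0 cos0 expR0 /c.
  rewrite /mu_density ln_odds// -/u; congr EFin.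
  have -> : expR u = t / (1 - t) by rewrite /u expRB !lnK ?posrE ?subr_gt0.
  move: (pi : R) p0 q0 => p p0 q0.
  by field; rewrite !lt0r_neq0 ?subr_gt0// addrC.
- exact: continuous_subspaceT.
- split.
  + by move=> s _; apply: ex_derive; exact: is_derive_kernel_primitive.
  + by apply: cvg_at_right_filter; exact: cK.
  + by apply: cvg_at_left_filter; exact: cK.
- move=> s _; rewrite derive1E; apply: derive_val.
  exact: is_derive_kernel_primitive.
Qed.

(** * The reflection t |-> 1 - t *)

Lemma measurable_onem : measurable_fun setT (fun t : R => 1 - t).
Proof. by apply: measurable_funB => //; exact: measurable_cst. Qed.

(** Lebesgue measure is determined by half-open intervals, and the reflection keeps their length
    although it exchanges the open and the closed end. *)
Lemma lebesgue_measure_onem (A : set R) : measurable A ->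
  pushforward mu (fun t : R => (1 - t)%R : measurableTypeR R) A = mu A.
Proof.
pose h := isMeasurableFun.Build _ _ (measurableTypeR R) (measurableTypeR R) _
  measurable_onem.
pose phi : {mfun measurableTypeR R >-> measurableTypeR R} :=
  HB.pack (fun t : R => 1 - t) h.
rewrite -[X in pushforward mu X]/(phi : _ -> _).
move=> mA; apply/esym.
apply: (@lebesgue_measure_unique _ (pushforward mu phi)) => //= _ [[a b]] _ <-.
rewrite /pushforward.
rewrite (_ : _ @^-1` _ = `[1 - b, 1 - a[%classic); last first.
  apply/seteqP; split=> t /=; rewrite !in_itv/= => /andP[]; lra.
rewrite !lebesgue_measure_itv/= !lte_fin ltrD2l ltrN2.
by case: ifPn => // _; rewrite -!EFinB; congr EFin; ring.
Qed.

Lemma ge0_integral_onem (f : R -> \bar R) :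
  measurable_fun (`]0%R, 1%R[%classic : set R) f ->
  (forall t, (0 < t < 1)%R -> 0 <= f t)%E ->
  (\int[mu]_(t in `]0%R, 1%R[) f t = \int[mu]_(t in `]0%R, 1%R[) f (1 - t)%R)%E.
Proof.
move=> mf f0.
rewrite [in RHS](_ : `]0%R, 1%R[%classic =
  (fun t : R => (1 - t)%R : measurableTypeR R) @^-1` `]0%R, 1%R[); last first.
  by apply/seteqP; split=> t /=; rewrite !in_itv/=; lra.
rewrite -(@ge0_integral_pushforward _ _ (measurableTypeR R) (measurableTypeR R) R _
  measurable_onem lebesgue_measure _ f)//=; last first.
  by move=> t; rewrite inE/= in_itv/=; exact: f0.
apply: eq_measure_integral => /= [|_ A mA _].
  exact: measurable_onem.
exact/esym/lebesgue_measure_onem.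
Qed.
End kernels.

(** * Positive and negative parts, and integrals of differences *)

Section funeposneg_scale.
Context (T : Type) (R : realType) (w : T -> R) (h : T -> \bar R) (x : T).
Hypothesis w0 : 0 <= w x.
Local Open Scope ereal_scope.

Lemma funepos_scale : (fun y => (w y)%:E * h y)^\+ x = (w x)%:E * h^\+ x.
Proof. by rewrite !funeposE maxe_pMr// mule0. Qed.

Lemma funeneg_scale : (fun y => (w y)%:E * h y)^\- x = (w x)%:E * h^\- x.
Proof. by rewrite !funenegE maxe_pMr// mule0 muleN. Qed.

End funeposneg_scale.

Section integral_lemmas.
Context d (T : measurableType d) (R : realType).
Variables (mu : {measure set T -> \bar R}) (D : set T).
Hypothesis mD : measurable D.
Local Open Scope ereal_scope.

(* Unlike [integralB], this allows one of the two integrals to be infinite: the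
   identity [c^+ + b = a + c^-] for [c = a - b] holds even at points where [a] or [b]
   is infinite. *)
Lemma ge0_integralB (a b : T -> \bar R) :
  measurable_fun D a -> measurable_fun D b ->
  (forall x, D x -> 0 <= a x) -> (forall x, D x -> 0 <= b x) ->
  \int[mu]_(x in D) a x < +oo \/ \int[mu]_(x in D) b x < +oo ->
  \int[mu]_(x in D) (a x - b x) = \int[mu]_(x in D) a x - \int[mu]_(x in D) b x.
Proof.
move=> ma mb a0 b0 ab.
pose c x := a x - b x.
have mc : measurable_fun D c by exact: emeasurable_funB.
have mcp : measurable_fun D c^\+ by exact: measurable_funepos.
have mcn : measurable_fun D c^\- by exact: measurable_funeneg.
have split : \int[mu]_(x in D) c^\+ x + \int[mu]_(x in D) b x =
    \int[mu]_(x in D) a x + \int[mu]_(x in D) c^\- x.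
  rewrite -!ge0_integralD//.
  apply: eq_integral => x; rewrite inE => Dx; rewrite funeposE funenegE /c.
  move: (a0 x Dx) (b0 x Dx); case: (a x) => [u| |]//; case: (b x) => [v| |]//=.
  all: rewrite ?addeNy ?addye// ?maxNye ?maxye ?add0e ?adde0 ?addye ?addey//.
  move=> u0 v0; rewrite -EFinB -!EFin_max -!EFinD; congr EFin.
  by rewrite !maxEle; case: (leP (u - v)%R 0%R); case: (leP (- (u - v))%R 0%R); lra.
(* With the next bound, a finite integral of [a] (resp. [b]) makes that of the positive (resp.
   negative) part of [c] finite, so [split] can be solved for the difference. *)
have cpa : \int[mu]_(x in D) c^\+ x <= \int[mu]_(x in D) a x.
  apply: ge0_le_integral => // x Dx; rewrite funeposE ge_max a0// andbT /c.
  by rewrite -[leRHS]adde0 leeD2l// leeNl oppe0 b0.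
have cnb : \int[mu]_(x in D) c^\- x <= \int[mu]_(x in D) b x.
  apply: ge0_le_integral => // x Dx; rewrite funenegE ge_max b0// andbT /c.
  move: (a0 x Dx) (b0 x Dx); case: (a x) => [u| |]//; case: (b x) => [v| |]//=.
    by rewrite !lee_fin; lra.
  by rewrite leNye.
rewrite [LHS]integralE.
have a0' := integral_ge0 mu a0; have b0' := integral_ge0 mu b0.
have p0 : 0 <= \int[mu]_(x in D) c^\+ x by exact: integral_ge0.
have n0 : 0 <= \int[mu]_(x in D) c^\- x by exact: integral_ge0.
move: split cpa cnb a0' b0' p0 n0 ab.
move: (\int[mu]_(x in D) c^\+ x) (\int[mu]_(x in D) c^\- x)
  (\int[mu]_(x in D) a x) (\int[mu]_(x in D) b x).
case=> [p| |]; case=> [n| |]; case=> [u| |]; case=> [v| |]//=.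
all: try by move=> _ _ _ _ _ _ _ [].
by case=> pv *; rewrite -!EFinB; congr EFin; lra.
Qed.

(** No integrability is assumed: if both parts have infinite integral, the two sides are -oo for c >
    0, and for c = 0 they vanish. *)
Lemma ge0_scale_integral (c : R) (f : T -> \bar R) : (0 <= c)%R ->
  measurable_fun D f ->
  c%:E * \int[mu]_(x in D) f x =
  \int[mu]_(x in D) (c%:E * f^\+ x) - \int[mu]_(x in D) (c%:E * f^\- x).
Proof.
move=> c0 mf; rewrite integralE.
rewrite !ge0_integralZl//; try exact: measurable_funepos; try exact: measurable_funeneg.
have : 0 <= \int[mu]_(x in D) f^\+ x by exact: integral_ge0.
have : 0 <= \int[mu]_(x in D) f^\- x by exact: integral_ge0.
move: (\int[mu]_(x in D) f^\+ x) (\int[mu]_(x in D) f^\- x).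
move: c0; rewrite le_eqVlt => /predU1P[<-|c0]; first by move=> *; rewrite !mul0e sube0.
case=> [u| |]; case=> [v| |]//= _ _.
- by rewrite -!EFinM -!EFinB mulrBr.
- by rewrite gt0_muleNy ?lte_fin// gt0_muley ?lte_fin.
- by rewrite gt0_muley ?lte_fin.
- by rewrite /= gt0_muleNy ?gt0_muley ?lte_fin.
Qed.
End integral_lemmas.

(** * Exchanging the averages over s and over t *)

Section tonelli.
Variable R : realType.
Local Notation mu := (@lebesgue_measure R).
Local Notation I := (`]0%R, 1%R[%classic : set R).
Local Open Scope ereal_scope.
Implicit Types G H : R -> \bar R.

(** On the open square the kernel agrees with a composition of exp, ln and sin that is jointly
    measurable on the whole plane. *)
Lemma measurable_kernel_pair :
  measurable_fun (I `*` I) (fun z : R * R => kernel z.1 z.2).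
Proof.
pose k (z : R * R) : R := (sin (pi * z.1) / pi *
  expR ((ln z.2 - ln (1 - z.2)) * z.1 - ln z.2))%R.
apply: (@eq_measurable_fun _ _ _ _ _ k).
  move=> z; rewrite inE/= !in_itv/= => -[_ z01]; rewrite /k kernelE// expRB lnK//.
  by case/andP : z01.
have mln1 : measurable_fun setT (fun z : R * R => ln (1 - z.2)%R).
  apply: measurableT_comp => //.
  by apply: measurable_funB => //; exact: measurable_cst.
have mln2 : measurable_fun setT (fun z : R * R => ln z.2).
  exact: measurableT_comp.
apply: measurable_funTS; apply: measurable_funM.
  apply: measurable_funM => //; apply: measurableT_comp.
    by apply: continuous_measurable_fun; exact: continuous_sin.
  by apply: measurable_funM => //; exact: measurable_cst.
apply: measurableT_comp => //; apply: measurable_funB => //.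
by apply: measurable_funM => //; exact: measurable_funB.
Qed.

Lemma measurable_kernel_fst (t : R) : (0 < t < 1)%R ->
  measurable_fun I (fun s => kernel s t).
Proof.
move=> t01; apply: (eq_measurable_fun _ (fun s _ => esym (kernelE s t01))).
apply: measurable_funTS; apply: measurable_funM.
  apply: measurable_funM => //; apply: measurableT_comp.
    by apply: continuous_measurable_fun; exact: continuous_sin.
  by apply: measurable_funM => //; exact: measurable_cst.
by apply: measurable_funM => //; apply: measurableT_comp.
Qed.

Lemma measurable_kernel_weight (s : R) :
  measurable_fun I (fun t => t `^ (s - 1) / (1 - t) `^ s)%R.
Proof.
apply: (@eq_measurable_fun _ _ _ _ _
    (fun t => expR ((s - 1) * ln t - s * ln (1 - t)))%R).
  move=> t; rewrite inE/= in_itv/= => /andP[t0 t1].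
  by rewrite expRB /powR !gt_eqF ?subr_gt0.
apply: measurable_funTS; apply: measurableT_comp => //.
apply: measurable_funB; apply: measurable_funM => //.
apply: measurableT_comp => //.
by apply: measurable_funB => //; exact: measurable_cst.
Qed.

Definition kernel_integral G (s : R) : \bar R :=
  \int[mu]_(t in I) ((kernel s t)%:E * G t).

(** Extended by zero outside the open square, so that Tonelli applies on the whole plane. *)
Let integrand G := (fun z : R * R => (kernel z.1 z.2)%:E * G z.2) \_ (I `*` I).

Let measurable_integrand G :
  measurable_fun setT G -> measurable_fun setT (integrand G).
Proof.
move=> mG; apply/(measurable_restrictT _ _).1; first exact: measurableX.
apply: emeasurable_funM.
  by apply/measurable_EFinP; exact: measurable_kernel_pair.
by apply: measurable_funTS; exact: measurableT_comp.
Qed.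

Let integrand_ge0 G : (forall t, 0 <= G t) -> forall z, 0 <= integrand G z.
Proof.
move=> G0 z; apply: erestrict_ge0 => {z} -[s t] [] /=; rewrite !in_itv/= => s01 t01.
by rewrite mule_ge0// lee_fin kernel_ge0.
Qed.

Let kernel_integralE G :
  kernel_integral G \_ I = (fun s => \int[mu]_t integrand G (s, t)).
Proof.
apply/funext => s; rewrite patchE; case: ifPn => sI.
  rewrite /kernel_integral integral_mkcond; apply: eq_integral => t _.
  rewrite /integrand !patchE.
  have [tI|tI] := boolP (t \in I); first by rewrite mem_set//; split; exact: set_mem.
  by rewrite memNset// => -[_ /mem_set]; rewrite (negbTE tI).
rewrite integral0_eq// => t _; rewrite /integrand patchE memNset//.
by move=> -[/mem_set]; rewrite (negbTE sI).
Qed.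

Lemma kernel_integral_ge0 G s : (0 < s < 1)%R -> (forall t, 0 <= G t) ->
  0 <= kernel_integral G s.
Proof.
move=> s01 G0; apply: integral_ge0 => t; rewrite /= in_itv/= => t01.
by rewrite mule_ge0// lee_fin kernel_ge0.
Qed.

Lemma measurable_kernel_integral G : measurable_fun setT G ->
  (forall t, 0 <= G t) -> measurable_fun I (kernel_integral G).
Proof.
move=> mG G0; apply/(measurable_restrictT _ _).2 => //.
rewrite kernel_integralE; apply: measurable_fun_fubini_tonelli_F.
  exact: measurable_integrand.
exact: integrand_ge0.
Qed.

(** After Tonelli the inner integral over s is [integral_kernel]. *)
Lemma integral_kernel_integral G : measurable_fun setT G ->
  (forall t, 0 <= G t) ->
  \int[mu]_(s in I) kernel_integral G s =
  \int[mu]_(t in I) ((mu_density t)%:E * G t).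
Proof.
move=> mG G0; rewrite integral_mkcond kernel_integralE.
transitivity (\int[mu]_t \int[mu]_s integrand G (s, t)).
  apply: (@fubini_tonelli _ _ _ _ R lebesgue_measure lebesgue_measure).
    exact: measurable_integrand.
  exact: integrand_ge0.
rewrite [RHS]integral_mkcond; apply: eq_integral => t _.
rewrite patchE; case: ifPn => tI; last first.
  rewrite integral0_eq// => s _; rewrite /integrand patchE memNset//.
  by move=> -[_ /mem_set]; rewrite (negbTE tI).
have t01 : (0 < t < 1)%R by move: tI; rewrite inE/= in_itv.
rewrite -(integral_kernel t01) -ge0_integralZr//; last 2 first.
- by apply/measurable_EFinP; exact: measurable_kernel_fst.
- by move=> s; rewrite /= in_itv/= => s01; rewrite lee_fin kernel_ge0.
rewrite [RHS]integral_mkcond; apply: eq_integral => s _.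
rewrite /integrand !patchE.
have [sI|sI] := boolP (s \in I); first by rewrite mem_set//; split; exact: set_mem.
by rewrite memNset// => -[/mem_set]; rewrite (negbTE sI).
Qed.

(** Signed version: [geo s] is the difference of the kernel integrals of the two parts of [H].
    Tonelli treats each part, and the finiteness hypothesis is what [ge0_integralB] needs to
    recombine them. Measurability of [geo] later allows replacing [0, 1] by ]0, 1[. *)
Lemma integral_kernel_swap H : measurable_fun setT H ->
  \int[mu]_(t in I) ((mu_density t)%:E * H^\+ t) < +oo \/
  \int[mu]_(t in I) ((mu_density t)%:E * H^\- t) < +oo ->
  let geo s := (sin (pi * s) / pi)%:E *
    \int[mu]_(t in I) ((t `^ (s - 1) / (1 - t) `^ s)%:E * H t) in
  measurable_fun I geo /\
  \int[mu]_(s in I) geo s = \int[mu]_(t in I) ((mu_density t)%:E * H t).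
Proof.
move=> mH fin geo.
have mHp : measurable_fun setT H^\+ by exact: measurable_funepos.
have mHn : measurable_fun setT H^\- by exact: measurable_funeneg.
have geoE s : I s -> geo s = kernel_integral H^\+ s - kernel_integral H^\- s.
  rewrite /= in_itv/= => s01; have p0 := pi_gt0 R; have /andP[s0 s1] := s01.
  have c0 : (0 <= sin (pi * s) / pi)%R.
    rewrite divr_ge0 ?(ltW p0)// sin_ge0_pi//.
    by rewrite mulr_ge0 ?ltW//= gtr_pMr.
  have w0 t : (0 <= t `^ (s - 1) / (1 - t) `^ s)%R by rewrite divr_ge0 ?powR_ge0.
  rewrite /geo ge0_scale_integral//.
    congr (_ - _); apply: eq_integral => t _.
      rewrite (_ : (fun _ => _)^\+ t = (t `^ (s - 1) / (1 - t) `^ s)%:E * H^\+ t).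
        by rewrite muleA -EFinM.
      by rewrite funepos_scale.
    rewrite (_ : (fun _ => _)^\- t = (t `^ (s - 1) / (1 - t) `^ s)%:E * H^\- t).
      by rewrite muleA -EFinM.
    by rewrite funeneg_scale.
  apply: emeasurable_funM; last exact: measurable_funTS.
  by apply/measurable_EFinP; exact: measurable_kernel_weight.
have mK : measurable_fun I (fun s => kernel_integral H^\+ s - kernel_integral H^\- s).
  by apply: emeasurable_funB; apply: measurable_kernel_integral.
split.
  by apply: eq_measurable_fun mK => s; rewrite inE => /geoE.
transitivity (\int[mu]_(s in I) (kernel_integral H^\+ s - kernel_integral H^\- s)).
  by apply: eq_integral => s; rewrite inE => /geoE.
rewrite ge0_integralB//; last 5 first.
- exact: measurable_kernel_integral.
- exact: measurable_kernel_integral.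
- by move=> s; rewrite /= in_itv/= => s01; exact: kernel_integral_ge0.
- by move=> s; rewrite /= in_itv/= => s01; exact: kernel_integral_ge0.
- by rewrite !integral_kernel_integral.
rewrite !integral_kernel_integral//.
rewrite [RHS]integralE; congr (_ - _); apply: eq_integral => t;
  rewrite inE/= in_itv/= => /mu_density_ge0 m0.
  by rewrite funepos_scale.
by rewrite funeneg_scale.
Qed.
End tonelli.

(** * Averages against the probability [mu] *)

Section mu_mean.
Variable R : realType.
Local Notation mu := (@lebesgue_measure R).
Local Notation I := (`]0%R, 1%R[%classic : set R).
Local Open Scope ereal_scope.
Implicit Types phi psi : R -> \bar R.

Definition mu_mean phi : \bar R :=
  \int[mu]_(t in I) ((mu_density t)%:E * phi t).

Let measurable_mu_integrand phi : measurable_fun I phi ->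
  measurable_fun I (fun t => (mu_density t)%:E * phi t).
Proof.
move=> mphi; apply: emeasurable_funM => //.
by apply/measurable_EFinP; exact: measurable_mu_density.
Qed.

Let mu_integrand_ge0 phi : (forall t, (0 < t < 1)%R -> 0 <= phi t) ->
  forall t, I t -> 0 <= (mu_density t)%:E * phi t.
Proof.
move=> phi0 t; rewrite /= in_itv/= => t01.
by rewrite mule_ge0 ?phi0// lee_fin mu_density_ge0.
Qed.

(** Total mass one. Infinite constants are included: -oo is the value of the means when the family
    of affine functions is empty. *)
Lemma mu_mean_cst (c : \bar R) : mu_mean (cst c) = c.
Proof.
have ge0 (e : \bar R) : 0 <= e -> mu_mean (cst e) = e.
  move=> e0; rewrite /mu_mean ge0_integralZr//.
  - by rewrite integral_mu_density mul1e.
  - by apply/measurable_EFinP; exact: measurable_mu_density.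
  - by move=> t; rewrite /= in_itv/= => /mu_density_ge0; rewrite lee_fin.
have [/ge0//|c0] := leP 0 c.
rewrite -[RHS]oppeK -(ge0 (- c)); last by rewrite leeNr oppe0 ltW.
rewrite /mu_mean -integral_ge0N; last first.
  by apply: mu_integrand_ge0 => t _; rewrite /= leeNr oppe0 ltW.
by apply: eq_integral => t _; rewrite muleN oppeK.
Qed.

(** Reduces functions bounded below to nonnegative ones, for which integration is additive and
    monotone even with infinite values. The constant has a finite mean, so it can be subtracted. *)
Lemma mu_mean_shift (C : R) phi : (0 <= C)%R -> measurable_fun I phi ->
  (forall t, (0 < t < 1)%R -> (- C)%:E <= phi t) ->
  mu_mean phi = mu_mean (fun t => phi t + C%:E) - C%:E.
Proof.
move=> C0 mphi Cphi; rewrite -{2}(mu_mean_cst C%:E) /mu_mean.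
rewrite -ge0_integralB//.
- apply: eq_integral => t; rewrite inE/= in_itv/= => t01.
  have := Cphi t t01; have := mu_density_gt0 t01.
  case: (phi t) => [u| |]// m0 _; last by rewrite addye// gt0_muley// lte_fin.
  by rewrite -EFinD -!EFinM; congr EFin; ring.
- by apply: measurable_mu_integrand; apply: emeasurable_funD.
- exact: measurable_mu_integrand.
- apply: mu_integrand_ge0 => t t01.
  have := Cphi t t01; case: (phi t) => [u| |]//; rewrite ?leey//.
  by rewrite -EFinD !lee_fin; lra.
- by apply: mu_integrand_ge0 => t _; rewrite lee_fin.
- by right; rewrite -/(mu_mean (cst C%:E)) mu_mean_cst ltry.
Qed.

Lemma mu_mean_onem (C : R) phi : (0 <= C)%R -> measurable_fun I phi ->
  (forall t, (0 < t < 1)%R -> (- C)%:E <= phi t) ->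
  mu_mean (fun t => phi (1 - t)%R) = mu_mean phi.
Proof.
move=> C0 mphi Cphi.
have onemI (t : R) : (0 < t < 1 -> 0 < 1 - t < 1)%R by lra.
have mphi' : measurable_fun I (fun t => phi (1 - t)%R).
  apply: (@measurable_comp _ _ _ _ _ _ I) => //.
    by move=> _ [t /= + <-]; rewrite !in_itv/=; exact: onemI.
  by apply: measurable_funTS; exact: measurable_onem.
have Cphi' t : (0 < t < 1)%R -> (- C)%:E <= phi (1 - t)%R.
  by move=> /onemI; exact: Cphi.
rewrite (mu_mean_shift C0 mphi' Cphi') (mu_mean_shift C0 mphi Cphi).
congr (_ - _); rewrite [RHS]/mu_mean ge0_integral_onem; last 2 first.
- by apply: measurable_mu_integrand; exact: emeasurable_funD.
- move=> t t01; apply: (@mu_integrand_ge0 (fun t => phi t + C%:E)); last first.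
    by rewrite /= in_itv.
  move=> {t01}t t01.
  have := Cphi t t01; case: (phi t) => [u| |]//; rewrite ?leey//.
  by rewrite -EFinD !lee_fin; lra.
apply: eq_integral => t; rewrite inE/= in_itv/= => t01.
by rewrite mu_densityC.
Qed.

(** After adding C the three functions are nonnegative and the integral is linear and monotone on
    them; since the weights 1 - l and l sum to 1, C cancels at the end. *)
Lemma mu_mean_convex (C l : R) phi1 phi2 psi : (0 <= C)%R -> (0 < l < 1)%R ->
  measurable_fun I phi1 -> measurable_fun I phi2 -> measurable_fun I psi ->
  (forall t, (0 < t < 1)%R -> (- C)%:E <= phi1 t) ->
  (forall t, (0 < t < 1)%R -> (- C)%:E <= phi2 t) ->
  (forall t, (0 < t < 1)%R -> (- C)%:E <= psi t) ->
  (forall t, (0 < t < 1)%R -> psi t <= (1 - l)%:E * phi1 t + l%:E * phi2 t) ->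
  mu_mean psi <= (1 - l)%:E * mu_mean phi1 + l%:E * mu_mean phi2.
Proof.
move=> C0 /andP[l0 l1] m1 m2 m C1 C2 Cpsi conv.
have l1' : (0 < 1 - l)%R by rewrite subr_gt0.
pose sh phi t := phi t + C%:E.
have msh phi : measurable_fun I phi -> measurable_fun I (sh phi).
  by move=> ?; exact: emeasurable_funD.
have sh0 phi : (forall t, (0 < t < 1)%R -> (- C)%:E <= phi t) ->
    forall t, (0 < t < 1)%R -> 0 <= sh phi t.
  move=> Cphi t /Cphi; rewrite /sh; case: (phi t) => [u| |]//; rewrite ?leey//.
  by rewrite -EFinD !lee_fin; lra.
have int0 phi : (forall t, (0 < t < 1)%R -> (- C)%:E <= phi t) ->
    0 <= mu_mean (sh phi).
  by move=> Cphi; apply: integral_ge0; apply: mu_integrand_ge0; exact: sh0.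
have : mu_mean (sh psi) <=
    (1 - l)%:E * mu_mean (sh phi1) + l%:E * mu_mean (sh phi2).
  have mI phi : measurable_fun I phi ->
    measurable_fun I (fun t => (mu_density t)%:E * sh phi t).
    by move=> ?; apply: measurable_mu_integrand; exact: msh.
  have gI phi : (forall t, (0 < t < 1)%R -> (- C)%:E <= phi t) ->
      forall t, I t -> 0 <= (mu_density t)%:E * sh phi t.
    by move=> Cphi; apply: mu_integrand_ge0; exact: sh0.
  rewrite /mu_mean -!ge0_integralZl//; try by [rewrite lee_fin ltW|exact: mI|exact: gI].
  rewrite -ge0_integralD//; last 4 first.
  - by move=> t It; rewrite mule_ge0 ?gI// lee_fin ltW.
  - by apply: emeasurable_funM => //; exact: mI.
  - by move=> t It; rewrite mule_ge0 ?gI// lee_fin ltW.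
  - by apply: emeasurable_funM => //; exact: mI.
  apply: ge0_le_integral => //.
  - exact: gI.
  - exact: mI.
  - by apply: emeasurable_funD; apply: emeasurable_funM => //; exact: mI.
  move=> t; rewrite /= in_itv/= => t01.
  have := conv t t01; have := mu_density_gt0 t01.
  have := C1 t t01; have := C2 t t01; have := Cpsi t t01; rewrite /sh.
  case: (phi1 t) => [u| |]//; case: (phi2 t) => [v| |]//;
    case: (psi t) => [w| |]// _ _ _ m0.
  all: rewrite ?addye// ?(gt0_muley (_ : 0 < (mu_density t)%:E))
    ?(gt0_muley (_ : 0 < l%:E)) ?(gt0_muley (_ : 0 < (1 - l)%:E)) ?lte_fin//
    ?addye ?addey ?leey//.
  rewrite -?EFinD -?EFinM -?EFinD -?EFinM !lee_fin => h.
  rewrite [leRHS](_ : _ = mu_density t * ((1 - l) * u + l * v + C))%R; last by ring.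
  by rewrite ler_pM2l// lerD2r.
rewrite (mu_mean_shift C0 m1 C1) (mu_mean_shift C0 m2 C2) (mu_mean_shift C0 m Cpsi).
have := int0 _ C1; have := int0 _ C2; have := int0 _ Cpsi; rewrite -/(sh _).
rewrite -[X in mu_mean X - _ <= _]/(sh psi)
  -[X in (1 - l)%:E * (mu_mean X - _)]/(sh phi1)
  -[X in l%:E * (mu_mean X - _)]/(sh phi2).
case: (mu_mean (sh phi1)) => [u| |]//; case: (mu_mean (sh phi2)) => [v| |]//;
  case: (mu_mean (sh psi)) => [w| |]// _ _ _.
all: rewrite ?addye// ?(gt0_muley (_ : 0 < l%:E))
  ?(gt0_muley (_ : 0 < (1 - l)%:E)) ?lte_fin// ?addye ?addey ?leey//.
by rewrite -?EFinB -?EFinM -?EFinD !lee_fin; lra.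
Qed.
End mu_mean.

(** * Suprema of affine functions and their contracted averages *)

Section affine_sup.
Variable R : realType.
Local Notation I := (`]0%R, 1%R[%classic : set R).
Local Open Scope ereal_scope.
Implicit Types A : set (R * R).

(** Stands for t |-> (f !_t g)(x) at a fixed x, so that the rest of the argument takes place on the
    real line. *)
Definition affine_sup A (t : R) : \bar R :=
  ereal_sup [set (p.1 + p.2 * t)%:E | p in A].

Lemma affine_sup_set0 t : affine_sup set0 t = -oo.
Proof. by rewrite /affine_sup image_set0 ereal_sup0. Qed.

(** Gives measurability of a possibly uncountable supremum: a line exceeding [a] at t still does so
    near t. *)
Lemma affine_sup_lower_semicontinuous A : lower_semicontinuous (affine_sup A).
Proof.
move=> t a /ereal_sup_gt[_ [p Ap <-]]; rewrite lte_fin => at_.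
exists [set y | (a < p.1 + p.2 * y)%R].
  have : ((p.1 + p.2 * y)%R @[y --> t] --> (p.1 + p.2 * t)%R)%classic.
    apply: cvgD; first exact: cvg_cst.
    by apply: cvgM; [exact: cvg_cst|exact: cvg_id].
  by move=> /cvgr_gt; apply.
move=> y ay; apply: (@lt_le_trans _ _ (p.1 + p.2 * y)%:E); first by rewrite lte_fin.
by apply: ereal_sup_ubound; exists p.
Qed.

Lemma measurable_affine_sup A : measurable_fun setT (affine_sup A).
Proof.
by apply: lower_semicontinuous_measurable; exact: affine_sup_lower_semicontinuous.
Qed.

Lemma affine_sup_convex A (l a b : R) : A !=set0 -> (0 < l < 1)%R ->
  affine_sup A ((1 - l) * a + l * b) <=
  (1 - l)%:E * affine_sup A a + l%:E * affine_sup A b.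
Proof.
move=> A0 /andP[l0 l1]; apply: ge_ereal_sup => _ [p Ap <-].
rewrite [X in X%:E <= _](_ : _ =
  ((1 - l) * (p.1 + p.2 * a) + l * (p.1 + p.2 * b))%R); last by ring.
rewrite EFinD !EFinM leeD// lee_pmul2l ?lte_fin ?subr_gt0//.
  by apply: ereal_sup_ubound; exists p.
by apply: ereal_sup_ubound; exists p.
Qed.

Lemma affine_sup_bounded_below A : A !=set0 -> exists2 C : R, (0 <= C)%R &
  forall t, (0 < t < 1)%R -> (- C)%:E <= affine_sup A t.
Proof.
move=> [p Ap]; exists (`|p.1| + `|p.2|)%R; first by rewrite addr_ge0.
move=> t /andP[t0 t1]; apply: (@le_trans _ _ (p.1 + p.2 * t)%:E); last first.
  by apply: ereal_sup_ubound; exists p.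
rewrite lee_fin opprD lerD//; first by rewrite lerNl ler_normr lexx orbT.
rewrite lerNl (le_trans (ler_norm _))// normrN normrM ler_piMr//.
by rewrite gtr0_norm// ltW.
Qed.

(** The value of U_s at a point: s shrinks ]0, 1[ towards its midpoint before averaging. *)
Definition contraction_mean A (s : R) : \bar R :=
  mu_mean (fun t => affine_sup A (s * t + (1 - s) * 2^-1)%R).

Lemma measurable_contraction A (s : R) :
  measurable_fun I (fun t => affine_sup A (s * t + (1 - s) * 2^-1)%R).
Proof.
apply: measurable_funTS; apply: measurableT_comp; first exact: measurable_affine_sup.
apply: measurable_funD; last exact: measurable_cst.
by apply: measurable_funM => //; exact: measurable_cst.
Qed.

Lemma contraction_itv (s t : R) : (0 <= s <= 1 -> 0 < t < 1 ->
  0 < s * t + (1 - s) * 2^-1 < 1)%R.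
Proof. by move=> s01 t01; apply/andP; split; nra. Qed.

Lemma contraction_mean_set0 s : contraction_mean set0 s = -oo.
Proof.
rewrite /contraction_mean (_ : (fun _ => _) = cst -oo) ?mu_mean_cst//.
by apply/funext => t; exact: affine_sup_set0.
Qed.

Lemma contraction_mean0 A : contraction_mean A 0 = affine_sup A 2^-1.
Proof.
rewrite /contraction_mean -[RHS]mu_mean_cst; congr mu_mean; apply/funext => t.
by rewrite mul0r add0r subr0 mul1r.
Qed.

Lemma contraction_mean1 A : contraction_mean A 1 = mu_mean (affine_sup A).
Proof.
congr mu_mean; apply/funext => t.
by rewrite subrr mul0r addr0 mul1r.
Qed.

Lemma contraction_mean_convex A (s r l : R) :
  A !=set0 -> (0 <= s <= 1)%R -> (0 <= r <= 1)%R -> (0 < l < 1)%R ->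
  contraction_mean A ((1 - l) * s + l * r) <=
  (1 - l)%:E * contraction_mean A s + l%:E * contraction_mean A r.
Proof.
move=> A0 s01 r01 l01; have [C C0 Cle] := affine_sup_bounded_below A0.
apply: (mu_mean_convex C0 l01); try exact: measurable_contraction.
- by move=> t t01; apply: Cle; exact: contraction_itv.
- by move=> t t01; apply: Cle; exact: contraction_itv.
- by move=> t t01; apply: Cle; apply: contraction_itv => //; apply/andP; split; nra.
- move=> t t01.
  rewrite [X in affine_sup A X <= _](_ : _ = (1 - l) * (s * t + (1 - s) * 2^-1) +
    l * (r * t + (1 - r) * 2^-1))%R; last by ring.
  exact: affine_sup_convex.
Qed.

(** Jensen's inequality by symmetrisation: [phi] and its reflection have the same mean, and their
    half-sum dominates the value at 1/2. *)
Lemma contraction_mean_ge A (s : R) : (0 <= s <= 1)%R ->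
  affine_sup A 2^-1 <= contraction_mean A s.
Proof.
move=> s01; have [->|/set0P A0] := eqVneq A set0.
  by rewrite affine_sup_set0 leNye.
have [C C0 Cle] := affine_sup_bounded_below A0.
have half : (0 < (2^-1 : R) < 1)%R by rewrite invr_gt0 ltr0n/= invf_lt1 ?ltr1n.
rewrite -[leLHS]mu_mean_cst.
pose phi t := affine_sup A (s * t + (1 - s) * 2^-1)%R.
have mphi : measurable_fun I phi by exact: measurable_contraction.
have Cphi t : (0 < t < 1)%R -> (- C)%:E <= phi t.
  by move=> t01; apply: Cle; exact: contraction_itv.
have Cphi' t : (0 < t < 1)%R -> (- C)%:E <= phi (1 - t)%R.
  by move=> t01; apply: Cphi; lra.
have := @mu_mean_convex _ C 2^-1 phi (fun t => phi (1 - t)%R)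
  (cst (affine_sup A 2^-1)) C0 half mphi.
rewrite (mu_mean_onem C0)//.
have -> : (1 - 2^-1)%:E * mu_mean phi + 2^-1%:E * mu_mean phi = mu_mean phi.
  move: (mu_mean phi) => [u| |].
  - by rewrite -!EFinM -EFinD; congr EFin; field.
  - by rewrite !gt0_muley ?lte_fin ?subr_gt0//; case/andP: half.
  - by rewrite !gt0_muleNy ?lte_fin ?subr_gt0//; case/andP: half.
apply => //.
- apply: (@measurable_comp _ _ _ _ _ _ I) => //.
    by move=> _ [t /= + <-]; rewrite !in_itv/=; lra.
  by apply: measurable_funTS; exact: measurable_onem.
- by move=> t _; exact: Cle.
- move=> t t01; rewrite /= /phi.
  (* The contracted images of t and 1 - t have midpoint 1/2. *)
  rewrite [X in affine_sup A X <= _](_ : _ = (1 - 2^-1) * (s * t + (1 - s) * 2^-1) +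
    2^-1 * (s * (1 - t) + (1 - s) * 2^-1))%R; last by field.
  exact: affine_sup_convex.
Qed.

(** Supplies the finiteness for [integral_kernel_swap]: the positive part is zero if A is empty, and
    otherwise the negative part is at most a constant. *)
Lemma mu_mean_affine_sup_fin A :
  mu_mean (affine_sup A)^\+ < +oo \/ mu_mean (affine_sup A)^\- < +oo.
Proof.
have [->|/set0P A0] := eqVneq A set0; [left|right].
  rewrite (_ : _^\+ = cst 0); first by rewrite mu_mean_cst ltry.
  by apply/funext => t; rewrite funeposE affine_sup_set0 maxNye.
have [C C0 Cle] := affine_sup_bounded_below A0.
apply: (@le_lt_trans _ _ (mu_mean (cst C%:E))); last by rewrite mu_mean_cst ltry.
apply: ge0_le_integral => //.
- by move=> t; rewrite /= in_itv/= => t01; rewrite mule_ge0// lee_fin mu_density_ge0.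
- apply: emeasurable_funM; first by apply/measurable_EFinP; exact: measurable_mu_density.
  by apply: measurable_funTS; apply: measurable_funeneg; exact: measurable_affine_sup.
- apply: emeasurable_funM => //; first by apply/measurable_EFinP; exact: measurable_mu_density.
move=> t; rewrite /= in_itv/= => t01; rewrite lee_pmul2l ?lte_fin ?mu_density_gt0//.
by rewrite funenegE ge_max lee_fin C0 andbT leeNl; exact: Cle.
Qed.
End affine_sup.

(** * Dual addition on [-oo, +oo] *)

Section dual_addition.
Variable R : realType.
Local Open Scope ereal_scope.

(** The two sums differ only for opposite infinities, where the dual one is +oo; upper bounds thus
    pass to the dual convention. *)
Lemma adde_le_dual_adde (a b : \bar R) : a + b <= (a + b)%dE.
Proof. by case: a => [u| |]; case: b => [v| |]; rewrite ?leey ?leNye. Qed.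

Lemma dual_arithmetic_le (s : R) (a b : \bar R) : (0 < s < 1)%R -> a <= b ->
  ((1 - s)%:E * a + (s%:E * b)%E)%dE <= b.
Proof.
move=> /andP[s0 s1] ab; have s1' : (0 < 1 - s)%R by rewrite subr_gt0.
move: ab; case: b => [b| |]; last 2 first.
- by move=> _; exact: leey.
- by rewrite leeNy_eq => /eqP ->; rewrite !gt0_muleNy ?lte_fin.
case: a => [a| |]//; last by rewrite gt0_muleNy.
rewrite -!EFinM lee_fin => ab.
rewrite [X in X <= _](_ : _ = ((1 - s) * a + s * b)%:E)// lee_fin.
rewrite -subr_ge0 (_ : _ - _ = (1 - s) * (b - a))%R; last by ring.
by rewrite mulr_ge0 ?subr_ge0// ltW.
Qed.
End dual_addition.

(** * Reduction of the means at a point to suprema of affine functions *)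

Section means.
Variables (R : realType) (k : scalar_kind) (E : tvsType (scalars R k)).
Implicit Types f g : E -> \bar R.
Local Notation mu := (@lebesgue_measure R).
Local Notation I := (`]0%R, 1%R[%classic : set R).

Lemma conjugate_neqNy f xs : proper_functional f -> conjugate f xs != -oo%E.
Proof.
move=> [fNy [x fy]]; rewrite -ltNye.
apply: (@lt_le_trans _ _ ((pairing xs x)%:E - f x)%dE).
  by move: (fNy x) fy; case: (f x) => [r| |]// _ _; exact: ltNyr.
by apply: ereal_sup_ubound; exists x.
Qed.

(** Where both conjugates are finite, with values a and b, [xs] contributes a line in t of slope a -
    b. Properness excludes -oo, and a conjugate equal to +oo contributes -oo, which leaves the
    supremum unchanged. The family does not depend on t. *)
Lemma harmonic_fmean_affine_sup f g x :
  proper_functional f -> proper_functional g ->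
  exists A : set (R * R), forall t, 0 < t < 1 ->
    harmonic_fmean t f g x = affine_sup A t.
Proof.
move=> pf pg.
exists [set p | exists xs a b, [/\ conjugate f xs = a%:E, conjugate g xs = b%:E &
  p = (pairing xs x - a, a - b)]].
move=> t /andP[t0 t1]; rewrite /harmonic_fmean gt_eqF// lt_eqF//.
have t1' : 0 < 1 - t by rewrite subr_gt0.
apply/eqP; rewrite eq_le; apply/andP; split.
  apply: ge_ereal_sup => _ [xs _ <-]; rewrite /arithmetic_fmean gt_eqF// lt_eqF//.
  have := conjugate_neqNy xs pf; have := conjugate_neqNy xs pg.
  case Ef : (conjugate f xs) => [a| |]//; case Eg : (conjugate g xs) => [b| |]// _ _.
  - apply: ereal_sup_ubound; exists (pairing xs x - a, a - b); last first.
      by rewrite -!EFinM; congr EFin; rewrite /=; ring.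
    by exists xs, a, b.
  - by rewrite gt0_muley ?lte_fin// leNye.
  - by rewrite gt0_muley ?lte_fin// leNye.
  - by rewrite !gt0_muley ?lte_fin// leNye.
apply: ge_ereal_sup => _ [p [xs [a [b [Ef Eg ->]]]] <-].
apply: ereal_sup_ubound; exists xs => //.
rewrite /arithmetic_fmean gt_eqF// lt_eqF// Ef Eg -!EFinM.
by congr EFin; rewrite /=; ring.
Qed.

Lemma means_contraction_mean f g x :
  proper_functional f -> proper_functional g ->
  exists A : set (R * R), [/\ harmonic_fmean 2^-1 f g x = affine_sup A 2^-1,
    forall s, 0 <= s <= 1 -> U_fmean f g s x = contraction_mean A s &
    logarithmic_fmean f g x = contraction_mean A 1].
Proof.
move=> pf pg; have [A hA] := harmonic_fmean_affine_sup x pf pg; exists A; split.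
- by apply: hA; rewrite invr_gt0 ltr0n/= invf_lt1 ?ltr1n.
- move=> s s01; apply: eq_integral => t; rewrite inE/= in_itv/= => t01.
  by rewrite hA// contraction_itv.
have [mgeo intgeo] := integral_kernel_swap (@measurable_affine_sup _ A)
  (mu_mean_affine_sup_fin A).
have geoE s : I s -> geometric_fmean s f g x = ((sin (pi * s) / pi)%:E *
  \int[mu]_(t in I) ((t `^ (s - 1) / (1 - t) `^ s)%:E * affine_sup A t))%E.
  rewrite /= in_itv/= => /andP[s0 s1]; rewrite /geometric_fmean gt_eqF// lt_eqF//.
  congr (_ * _)%E; apply: eq_integral => t; rewrite inE/= in_itv/= => t01.
  by rewrite hA.
rewrite contraction_mean1 /mu_mean -intgeo /logarithmic_fmean.
(* The endpoints, where [geometric_fmean] takes its conventional values, are negligible. *)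
rewrite integral_itv_bndoo; last first.
  by apply: eq_measurable_fun mgeo => s; rewrite inE => /geoE ->.
by apply: eq_integral => s; rewrite inE => /geoE.
Qed.
End means.

Lemma contraction_mean_arithmetic (R : realType) (A : set (R * R)) (s r l : R) :
  0 <= s <= 1 -> 0 <= r <= 1 -> 0 < l < 1 ->
  (contraction_mean A ((1 - l) * s + l * r) <=
  (((1 - l)%:E * contraction_mean A s)%E + (l%:E * contraction_mean A r)%E)%dE)%E.
Proof.
move=> s01 r01 l01; have [->|/set0P A0] := eqVneq A set0.
  by rewrite contraction_mean_set0 leNye.
exact: le_trans (contraction_mean_convex A0 s01 r01 l01) (adde_le_dual_adde _ _).
Qed.

(** A convex function on [0, 1] with its minimum at 0 increases: s is the combination of 0 and r
    with weight s / r on r, and the value at 0 is at most the value at r. *)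
Lemma contraction_mean_homo (R : realType) (A : set (R * R)) (s r : R) :
  0 <= s -> s <= r -> r <= 1 -> (contraction_mean A s <= contraction_mean A r)%E.
Proof.
move=> s0; rewrite le_eqVlt => /predU1P[->//|sr] r1.
have r0 := le_lt_trans s0 sr.
have [->|sn0] := eqVneq s 0.
  by rewrite contraction_mean0; apply: contraction_mean_ge; rewrite ltW.
have l01 : 0 < s / r < 1.
  by rewrite ltr_pdivrMr// mul1r sr andbT divr_gt0// lt_neqAle eq_sym sn0.
have r01 : 0 <= r <= 1 by rewrite r1 ltW.
have := @contraction_mean_arithmetic _ A 0 r (s / r) _ r01 l01.
rewrite mulr0 add0r divfK ?gt_eqF// lexx ler01 => /(_ isT) /le_trans; apply.
apply: dual_arithmetic_le => //.
by rewrite contraction_mean0 contraction_mean_ge.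
Qed.

Theorem theorem7p10 (R : realType) (k : scalar_kind)
    (E : tvsType (scalars R k)) (f g : E -> \bar R)
    (hf : Gamma0 f) (hg : Gamma0 g) :
  (* (i) *)
  pointwisely_convex `[0, 1] (U_fmean f g) /\
  (* (ii) *)
  (forall s : R, 0 <= s <= 1 ->
     [/\ pointwise_le (harmonic_fmean 2^-1 f g) (U_fmean f g s),
         pointwise_le (U_fmean f g s)
           (arithmetic_fmean s (harmonic_fmean 2^-1 f g) (logarithmic_fmean f g))
       & pointwise_le (arithmetic_fmean s (harmonic_fmean 2^-1 f g) (logarithmic_fmean f g))
           (logarithmic_fmean f g)]) /\
  (* (iii) *)
  (pointwise_inf `[0, 1] (U_fmean f g) = harmonic_fmean 2^-1 f g /\
   pointwise_sup `[0, 1] (U_fmean f g) = logarithmic_fmean f g) /\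
  (* (iv) *)
  pointwisely_increasing `[0, 1] (U_fmean f g).
Proof.
have [[_ _ pf] [_ _ pg]] := (hf, hg).
have ex x := means_contraction_mean x pf pg.
have z01 : 0 <= (0 : R) <= 1 by rewrite lexx ler01.
have o01 : 0 <= (1 : R) <= 1 by rewrite lexx ler01.
(* Monotonicity comes first: with U_0 = f ! g and U_1 = L, the outer bounds of (ii) and both extrema
   of (iii) follow from it. *)
have U_homo s r x : 0 <= s -> s <= r -> r <= 1 ->
    (U_fmean f g s x <= U_fmean f g r x)%E.
  move=> s0 sr r1; have [A [_ UE _]] := ex x.
  rewrite !UE; first exact: contraction_mean_homo.
    by rewrite r1 (le_trans s0).
  by rewrite s0 (le_trans sr).
have U0 x : U_fmean f g 0 x = harmonic_fmean 2^-1 f g x.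
  by have [A [-> -> // _]] := ex x; exact: contraction_mean0.
have U1 x : U_fmean f g 1 x = logarithmic_fmean f g x.
  by have [A [_ -> // ->]] := ex x.
have U_convex : pointwisely_convex `[0, 1] (U_fmean f g).
  move=> s r l; rewrite /= !in_itv/= => s01 r01 /andP[l0 l1] x.
  rewrite /arithmetic_fmean.
  (* The weights 0 and 1 fall under the conventions of [arithmetic_fmean], so no product with a zero
     scalar arises. *)
  have [->|ln0] := eqVneq l 0; first by rewrite subr0 mul1r mul0r addr0.
  have [->|ln1] := eqVneq l 1; first by rewrite subrr mul1r mul0r add0r.
  have l01 : 0 < l < 1 by rewrite !lt_neqAle l0 l1 ln1 eq_sym ln0.
  have [A [_ UE _]] := ex x.
  rewrite !UE//; first exact: contraction_mean_arithmetic.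
  by apply/andP; split; nra.
split; [exact: U_convex|split; [|split; [split|]]].
- move=> s s01; have /andP[s0 s1] := s01; split=> x.
  + by rewrite -U0; exact: U_homo.
  (* The middle bound is convexity between the endpoints 0 and 1, with weight s. *)
  + have := U_convex 0 1 s; rewrite /= !in_itv/= => /(_ z01 o01 s01 x).
    by rewrite mulr0 add0r mulr1 /arithmetic_fmean U0 U1.
  + rewrite /arithmetic_fmean.
    have hL : (harmonic_fmean 2^-1 f g x <= logarithmic_fmean f g x)%E.
      by rewrite -U0 -U1; exact: U_homo.
    have [//|sn0] := eqVneq s 0; have [//|sn1] := eqVneq s 1.
    by apply: dual_arithmetic_le => //; rewrite !lt_neqAle s0 s1 sn1 eq_sym sn0.
- apply/funext => x; apply/eqP; rewrite eq_le; apply/andP; split.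
    by rewrite -U0; apply: ereal_inf_lbound; exists 0; rewrite //= in_itv.
  apply: le_ereal_inf_tmp => _ [s + <-]; rewrite /= in_itv/= => /andP[s0 s1].
  by rewrite -U0; exact: U_homo.
- apply/funext => x; apply/eqP; rewrite eq_le; apply/andP; split.
    apply: ge_ereal_sup => _ [s + <-]; rewrite /= in_itv/= => /andP[s0 s1].
    by rewrite -U1; exact: U_homo.
  by rewrite -U1; apply: ereal_sup_ubound; exists 1; rewrite //= in_itv.
- move=> s r; rewrite /= !in_itv/= => /andP[s0 _] /andP[_ r1] sr x.
  exact: U_homo.
Qed.
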